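(* For every $m\in\mathbb Z$ and every $q\in\mathbb C$ with $|q|\neq 1$ (and $q\ne 0$), the $3\times 3$ matrix $$\mathbf J_m(q)=\begin{pmatrix}1 & G^{(2)}_m(q) & G^{(2)}_{m+1}(q)\\ 0 & G^{(1)}_m(q) & G^{(1)}_{m+1}(q)\\ 0& G^{(0)}_m(q) & G^{(0)}_{m+1}(q)\end{pmatrix}$$ satisfies $$\mathbf J_{m+1}(q)=\mathbf J_m(q)\,A(q^m,q),\qquad A(q^m,q)=\begin{pmatrix}1&0&1\\0&0&-1\\0&1&2-q^{m+1}\end{pmatrix},$$ has $\det \mathbf J_m(q)=-1$, and satisfies $$\mathbf J_m(q^{-1})=\begin{pmatrix}1&0&0\\0&-1&0\\0&0&1\end{pmatrix}\mathbf J_{-m-1}(q)\begin{pmatrix}1&0&0\\0&0&1\\0&1&0\end{pmatrix}.$$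
   Context: Notation: $(a;q)_n=\prod_{j=0}^{n-1}(1-aq^j)$. For $|q|<1$ and integers $k\ge1$, $n\ge 0$, put $E_k^{(n)}(q)=\sum_{s\ge1}s^{k-1}\frac{q^{s(n+1)}}{1-q^s}$ and $E_2(q)=1-24E_2^{(0)}(q)$. For $|q|<1$ and $m\in\mathbb Z$ define $G^{(0)}_m(q)=\sum_{n\ge0}(-1)^n\frac{q^{n(n+1)/2+mn}}{(q;q)_n^2}$, $G^{(1)}_m(q)=\sum_{n\ge0}\big(n+m+\tfrac12-2E_1^{(n)}(q)\big)(-1)^n\frac{q^{n(n+1)/2+mn}}{(q;q)_n^2}$, $G^{(2)}_m(q)=\sum_{n\ge0}\Big(\tfrac12\big(n+m+\tfrac12-2E_1^{(n)}(q)\big)^2-E_2^{(n)}(q)-\tfrac1{24}E_2(q)\Big)(-1)^n\frac{q^{n(n+1)/2+mn}}{(q;q)_n^2}$. These are extended to $|q|>1$ by setting $G^{(j)}_m(q^{-1})=(-1)^jG^{(j)}_{-m}(q)$ for $|q|<1$, $j=0,1,2$. *)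

(* Defs.v *)
From HB Require Import structures.
From mathcomp Require Import all_boot all_order all_algebra.
From mathcomp Require Import complex.
From mathcomp Require Import all_classical all_reals all_analysis.
Set Implicit Arguments. Unset Strict Implicit. Unset Printing Implicit Defensive.
Import Order.TTheory GRing.Theory Num.Theory.
Import numFieldNormedType.Exports.
Local Open Scope ring_scope.

Section Defs.
Variable R : realType.
Local Notation C := R[i].

Definition csum (a : nat -> C) : C :=
  Complex (limn (series (fun k => complex.Re (a k)))) (limn (series (fun k => complex.Im (a k)))).

Definition qpoch (a q : C) (n : nat) : C := \prod_(j < n) (1 - a * q ^+ j).

Definition Ekn (k n : nat) (q : C) : C :=
  csum (fun s => (s.+1)%:R ^+ k.-1 * q ^+ (s.+1 * n.+1) / (1 - q ^+ s.+1)).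

Definition E2 (q : C) : C := 1 - 24%:R * Ekn 2 0 q.

Definition Gterm (m : int) (q : C) (n : nat) : C :=
  (-1) ^+ n * q ^ ((n * n.+1)./2 %:Z + m * n%:Z) / (qpoch q q n) ^+ 2.

Definition Lnm (m : int) (q : C) (n : nat) : C :=
  n%:R + m%:~R + 2^-1 - 2%:R * Ekn 1 n q.

Definition G0s (m : int) (q : C) : C := csum (fun n => Gterm m q n).
Definition G1s (m : int) (q : C) : C := csum (fun n => Lnm m q n * Gterm m q n).
Definition G2s (m : int) (q : C) : C :=
  csum (fun n => (2^-1 * (Lnm m q n) ^+ 2 - Ekn 2 n q - 24%:R^-1 * E2 q) * Gterm m q n).

Definition Gs (j : nat) (m : int) (q : C) : C :=
  match j with 0%N => G0s m q | 1%N => G1s m q | _ => G2s m q end.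

Definition G (j : nat) (m : int) (q : C) : C :=
  if `|q| < 1 then Gs j m q else (-1) ^+ j * Gs j (- m) q^-1.

Definition mx3 (a b c d e f g h k : C) : 'M[C]_3 :=
  \matrix_(i < 3, j < 3)
     nth 0 (nth [::] [:: [:: a; b; c]; [:: d; e; f]; [:: g; h; k]] i) j.

Definition Jmx (m : int) (q : C) : 'M[C]_3 :=
  mx3 1 (G 2 m q) (G 2 (m + 1) q)
      0 (G 1 m q) (G 1 (m + 1) q)
      0 (G 0 m q) (G 0 (m + 1) q).

Definition Amx (m : int) (q : C) : 'M[C]_3 :=
  mx3 1 0 1
      0 0 (-1)
      0 1 (2%:R - q ^ (m + 1)).

End Defs.

(* Main.v *)
(** All three families satisfy the same second-order recursion in [m],
    inhomogeneous for [j = 2]: writing [c = q ^ (m + 1)], the [n]-th term of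
    [G_(m+2) - 2 G_(m+1) + G_m] is minus the [(n-1)]-st term of [c G_(m+1)], so
    the sum telescopes to its term at [n = 0], which is [0] for [j = 0, 1] and
    [1] for [j = 2].  For [|q| < 1] the Wronskian of [G^(1)] and [G^(0)] is hence
    independent of [m], and it tends geometrically to [-1] as [m] tends to
    infinity.  The case [|q| > 1] and the symmetry under [q -> 1/q] follow from
    the way [G] is extended. *)

Require Import Defs.
From HB Require Import structures.
From mathcomp Require Import all_boot all_order all_algebra.
From mathcomp Require Import complex.
From mathcomp Require Import all_classical all_reals all_analysis.
From mathcomp Require Import ring zify.
Import Order.TTheory GRing.Theory Num.Theory.
Import numFieldNormedType.Exports.
Local Open Scope ring_scope.

(** * Complex series, summed through real and imaginary parts *)

Section ComplexSeries.
Variable R : realType.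
Local Notation C := R[i].
Implicit Types (a b : nat -> C) (r s : C).

(** [csum] is built on [limn], which is meaningful only for convergent sequences, so its algebraic
    rules need this condition. *)
Definition csummable a :=
  cvgn (series (fun k => complex.Re (a k))) /\
  cvgn (series (fun k => complex.Im (a k))).

Lemma csumD a b : csummable a -> csummable b ->
  csum (fun n => a n + b n) = csum a + csum b.
Proof.
move=> [ar ai] [br bi]; rewrite /csum.
rewrite (_ : (fun k => complex.Re (a k + b k)) =
  (fun k => complex.Re (a k)) + (fun k => complex.Re (b k))); last first.
  by apply/funext => k /=; rewrite raddfD.
rewrite (_ : (fun k => complex.Im (a k + b k)) =
  (fun k => complex.Im (a k)) + (fun k => complex.Im (b k))); last first.
  by apply/funext => k /=; rewrite raddfD.
by rewrite !lim_seriesD.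
Qed.

Lemma csumZ (c : C) a : csummable a -> csum (fun n => c * a n) = c * csum a.
Proof.
case: c => x y [ar ai]; rewrite /csum.
rewrite (_ : (fun k => complex.Re (Complex x y * a k)) =
  x *: (fun k => complex.Re (a k)) - y *: (fun k => complex.Im (a k)));
  last first.
  apply/funext => k.
  change (complex.Re (Complex x y * a k) =
    x * complex.Re (a k) - y * complex.Im (a k)).
  by case: (a k).
rewrite (_ : (fun k => complex.Im (Complex x y * a k)) =
  x *: (fun k => complex.Im (a k)) + y *: (fun k => complex.Re (a k)));
  last first.
  apply/funext => k.
  change (complex.Im (Complex x y * a k) =
    x * complex.Im (a k) + y * complex.Re (a k)).
  by case: (a k).
have Z (u : nat -> R) k : cvgn (series u) -> cvgn (series (k *: u)).
  exact: is_cvg_seriesZ.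
rewrite (lim_seriesB (Z _ x ar) (Z _ y ai)) (lim_seriesD (Z _ x ai) (Z _ y ar)).
by rewrite !lim_seriesZ.
Qed.

Lemma lim_series_recl (u : nat -> R) : cvgn (series u) ->
  limn (series u) = u 0 + limn (series (fun n => u n.+1)).
Proof.
move=> cu; apply: cvg_lim => //; rewrite -cvg_shiftS.
have E n : series u n.+1 = u 0 + series (fun k => u k.+1) n.
  by rewrite /series /= big_nat_recl.
rewrite (_ : [sequence _]_n = fun n => u 0 + series (fun k => u k.+1) n);
  last exact/funext.
apply: cvgD; first exact: cvg_cst.
have := cu; rewrite -cvg_shiftS => /cvgP cu'.
rewrite (_ : series (fun k => u k.+1) = fun n => series u n.+1 - u 0); last first.
  by apply/funext => n; rewrite E addrC addKr.
by apply: is_cvgB => //; exact: is_cvg_cst.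
Qed.

Lemma csum_recl a : csummable a -> csum a = a 0 + csum (fun n => a n.+1).
Proof.
move=> [ar ai]; rewrite /csum (lim_series_recl _ ar) (lim_series_recl _ ai).
by case: (a 0).
Qed.

Lemma lim_series_geometric_bound (u : nat -> R) (M r : R) :
  0 <= M -> 0 <= r < 1 -> (forall n, `|u n| <= M * r ^+ n) ->
  cvgn (series u) /\ `|limn (series u)| <= M / (1 - r).
Proof.
move=> M0 /andP[r0 r1] uM.
have rn : `|r| < 1 by rewrite ger0_norm.
have cg : cvgn (series (geometric M r)) by exact: is_cvg_geometric_series.
have cn : cvgn [normed series u].
  by apply: series_le_cvg cg => n //=; rewrite mulr_ge0 // exprn_ge0.
split; first exact: normed_cvg.
apply: le_trans (lim_series_norm cn) _.
by rewrite -(cvg_lim _ (@cvg_geometric_series _ M r rn)) //; apply: lim_series_le.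
Qed.

Lemma normc_i : `|(0 +i* 1)%C : C| = 1.
Proof. by rewrite normc_def /= expr0n expr1n /= add0r sqrtr1. Qed.

Lemma normc_ge_Im (z : C) : (`|complex.Im z|%:C)%C <= `|z|.
Proof.
have := normc_ge_Re ((0 +i* 1)%C * z); rewrite normrM.
by rewrite normc_i mul1r; case: z => x y /=; rewrite mul0r mul1r sub0r normrN.
Qed.

(** The factor 2 comes from bounding the real and imaginary parts separately. *)
Lemma csum_geometric_bound a (M r : C) :
  0 <= M -> 0 <= r -> r < 1 -> (forall n, `|a n| <= M * r ^+ n) ->
  csummable a /\ `|csum a| <= 2 * M / (1 - r).
Proof.
move=> M0 r0 r1 aM.
have /complex_realP[M' ME] := ger0_real M0.
have /complex_realP[r' rE] := ger0_real r0.
move: M0 r0 r1 aM; rewrite {}ME {}rE ler0c => M0.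
rewrite ler0c => r0; rewrite (_ : 1 = 1%:C%C) // ltcR => r1 aM.
have aM' n (x : R) : (`|x|%:C)%C <= `|a n| -> `|x| <= M' * r' ^+ n.
  by move=> /le_trans/(_ (aM n)); rewrite -rmorphXn -rmorphM lecR.
have r01 : 0 <= r' < 1 by rewrite r0.
have [cr nr] := lim_series_geometric_bound _ _ _ M0 r01
  (fun n => aM' n _ (normc_ge_Re _)).
have [ci ni] := lim_series_geometric_bound _ _ _ M0 r01
  (fun n => aM' n _ (normc_ge_Im _)).
split; first by [].
rewrite -mulrA mulr2n mulrDl mul1r.
have E (x y : R) : (x +i* y)%C = (x%:C + (0 +i* 1) * y%:C)%C.
  by rewrite /real_complex_def; simpc.
have nC (x : R) : `|(x%:C)%C| = (`|x|%:C)%C.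
  by rewrite normc_def /= expr0n addr0 sqrtr_sqr.
rewrite /csum E; apply: le_trans (ler_normD _ _) _; rewrite normrM normc_i mul1r.
by rewrite !nC -rmorphB -fmorphV -rmorphM lerD // lecR.
Qed.

End ComplexSeries.

(** * Geometric domination of sequences *)

Section Domination.
Variable R : realType.
Local Notation C := R[i].
Implicit Types (a b : nat -> C) (r s : C).

(** Ratios of 1 and above are allowed, so growing weights and decaying terms are measured alike and
    can be multiplied. *)
Definition dominated r a := exists2 M : C, 0 <= M & forall n, `|a n| <= M * r ^+ n.

Lemma eq_dominated r a b : a =1 b -> dominated r a -> dominated r b.
Proof. by move=> ab [M M0 aM]; exists M => // n; rewrite -ab. Qed.

Lemma dominatedW r s a : 0 <= r -> r <= s -> dominated r a -> dominated s a.
Proof.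
move=> r0 rs [M M0 aM]; exists M => // n; apply: le_trans (aM n) _.
by rewrite ler_wpM2l // lerXn2r // nnegrE (le_trans r0).
Qed.

Lemma dominatedD r a b : dominated r a -> dominated r b ->
  dominated r (fun n => a n + b n).
Proof.
move=> [M M0 aM] [N N0 bN]; exists (M + N); first exact: addr_ge0.
by move=> n; rewrite mulrDl (le_trans (ler_normD _ _)) // lerD.
Qed.

Lemma dominatedM r s a b : dominated r a -> dominated s b ->
  dominated (r * s) (fun n => a n * b n).
Proof.
move=> [M M0 aM] [N N0 bN]; exists (M * N); first exact: mulr_ge0.
by move=> n; rewrite exprMn mulrACA normrM ler_pM.
Qed.

Lemma dominated_cst (c : C) : dominated 1 (fun=> c).
Proof. by exists `|c| => // n; rewrite expr1n mulr1. Qed.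

Lemma dominatedZ r (c : C) a : dominated r a -> dominated r (fun n => c * a n).
Proof. by rewrite -{2}[r]mul1r; apply: dominatedM; exact: dominated_cst. Qed.

Lemma dominated_expr (q : C) : dominated `|q| (fun n => q ^+ n).
Proof. by exists 1 => // n; rewrite normrX mul1r. Qed.

Lemma dominated_shift r a : 0 <= r -> dominated r a ->
  dominated r (fun n => a n.+1).
Proof.
move=> r0 [M M0 aM]; exists (M * r); first exact: mulr_ge0.
by move=> n; rewrite -mulrA -exprS.
Qed.

Lemma dominated_csummable r a : 0 <= r -> r < 1 -> dominated r a -> csummable _ a.
Proof.
by move=> r0 r1 [M M0 aM]; have [] := csum_geometric_bound _ _ _ _ M0 r0 r1 aM.
Qed.

(** Bernoulli's inequality gives [n * h <= (1 + h) ^+ n]. *)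
Lemma dominated_natr (h : C) : 0 < h -> dominated (1 + h) (fun n => n%:R).
Proof.
move=> h0; exists h^-1; first by rewrite invr_ge0 ltW.
have h1 : 0 <= 1 + h by rewrite addr_ge0 // ltW.
have bern n : 1 + n%:R * h <= (1 + h) ^+ n.
  elim: n => [|n IH]; first by rewrite mul0r addr0.
  rewrite exprSr; apply: le_trans (ler_wpM2r h1 IH).
  rewrite -subr_ge0 (_ : _ - _ = n%:R * h * h); last by rewrite -natr1; ring.
  by rewrite !mulr_ge0 // ltW.
move=> n; rewrite normr_nat ler_pdivlMl // mulrC; apply: le_trans (bern n).
by rewrite lerDr.
Qed.

(* A summable constant sequence has a sum S with S = c + S. *)
Lemma dominated_cst_eq0 r (c : C) : 0 <= r -> r < 1 ->
  dominated r (fun=> c) -> c = 0.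
Proof.
move=> r0 r1 /(dominated_csummable _ _ r0 r1)/csum_recl/eqP.
by rewrite -subr_eq subrr eq_sym => /eqP.
Qed.

(** If every power exceeded [e], the constant sequence [e] would be dominated with a ratio below 1,
    hence zero. *)
Lemma exprn_small r (e : C) : 0 <= r -> r < 1 -> 0 < e -> exists N, r ^+ N <= e.
Proof.
move=> r0 r1 e0; apply/not_existsP => H.
suff E : e = 0 by rewrite E ltxx in e0.
apply: (dominated_cst_eq0 _ _ r0 r1); exists 1 => // n; rewrite mul1r gtr0_norm //.
by have [//|/ltW/H] := real_leP (gtr0_real e0) (ger0_real (exprn_ge0 n r0)).
Qed.

Lemma dominated_ratio s a : 0 < s ->
  (exists N, forall n, (N <= n)%N -> `|a n.+1| <= s * `|a n|) -> dominated s a.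
Proof.
move=> s0 [N aN]; have sn0 n : 0 < s ^+ n by rewrite exprn_gt0.
(* [M] majorizes each [|a i| / s ^+ i] with [i <= N]; beyond [N] the ratio hypothesis propagates the
   bound. *)
pose M := \sum_(i < N.+1) `|a i| / s ^+ i.
have M0 (P : pred 'I_N.+1) : 0 <= \sum_(i < N.+1 | P i) `|a i| / s ^+ i.
  by apply: sumr_ge0 => i _; rewrite divr_ge0 // ltW.
exists M; first exact: M0.
have small n : (n <= N)%N -> `|a n| <= M * s ^+ n.
  move=> nN; rewrite -ler_pdivrMr // /M (bigD1 (Ordinal (nN : (n < N.+1)%N))) //=.
  by rewrite lerDl M0.
elim=> [|n IH]; first exact: small.
have [/small //|Nn] := leqP n.+1 N.
by rewrite exprS mulrCA (le_trans (aN _ Nn)) // ler_wpM2l // ltW.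
Qed.

Definition geo_dominated a := exists2 r, 0 <= r < 1 & dominated r a.

(** There is room between [r] and 1: [(1 + (1 - r) / 2) * r] is still below 1, and its first factor
    absorbs the linear growth. *)
Lemma geo_dominated_natrM a :
  geo_dominated a -> geo_dominated (fun n => n.+1%:R * a n).
Proof.
move=> [r /andP[r0 r1] ar]; have u0 : 0 < 1 - r by rewrite subr_gt0.
have h0 : 0 < (1 - r) / 2 by rewrite divr_gt0.
exists ((1 + (1 - r) / 2) * r).
  rewrite mulr_ge0 ?addr_ge0 ?(ltW h0) //= -subr_gt0.
  rewrite (_ : _ - _ = (1 - r) * (1 + (1 - r)) / 2); last by field.
  by rewrite divr_gt0 // mulr_gt0 // addr_gt0.
apply: dominatedM ar; apply: dominated_shift; last exact: dominated_natr.
by rewrite addr_ge0 // ltW.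
Qed.

Lemma geo_dominated_polyM j a :
  geo_dominated a -> geo_dominated (fun n => n.+1%:R ^+ j * a n).
Proof.
move=> ga; elim: j => [|j [r r01 IH]].
  by case: ga => r r01 ar; exists r => //; apply: eq_dominated ar => n; rewrite mul1r.
have [|s s01 H] := geo_dominated_natrM (fun n => n.+1%:R ^+ j * a n).
  by exists r.
by exists s => //; apply: eq_dominated H => n; rewrite exprS mulrA.
Qed.

(** Each term of index [n >= 1] carries [q ^+ (n * m)], of norm at most [|q| ^+ m], so the tail
    after index 0 is of that order. *)
Lemma csum_exprM_cvg (q : C) r a : `|q| <= 1 -> 0 <= r -> r < 1 -> dominated r a ->
  dominated `|q| (fun m => csum (fun n => (q ^+ n) ^+ m * a n) - a 0).
Proof.
move=> q1 r0 r1 [M M0 aM].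
exists (2 * (M * r) / (1 - r)).
  by rewrite divr_ge0 ?subr_ge0 ?(ltW r1) // !mulr_ge0.
(* Used with [k = 0] for summability and with [k = 1] for the tail. *)
have bound k m n : `|(q ^+ (n + k)) ^+ m * a (n + k)%N|
    <= `|q| ^+ (k * m) * (M * r ^+ k) * r ^+ n.
  rewrite normrM -exprM normrX -mulrA -[M * _ * _]mulrA -exprD addnC.
  rewrite ler_pM ?exprn_ge0 // mulnDl exprD ler_piMr ?exprn_ge0 //.
  by rewrite exprn_ile1.
move=> m; rewrite csum_recl; last first.
  have H n : `|(q ^+ n) ^+ m * a n| <= M * r ^+ n.
    by have := bound 0 m n; rewrite addn0 mul0n !expr0 !mulr1 mul1r.
  by have [] := csum_geometric_bound _ _ _ _ M0 r0 r1 H.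
rewrite expr0 expr1n mul1r addrC addKr.
have H n : `|(q ^+ n.+1) ^+ m * a n.+1| <= `|q| ^+ m * (M * r) * r ^+ n.
  by have := bound 1 m n; rewrite addn1 mul1n expr1.
have [|_] := csum_geometric_bound _ _ _ _ _ r0 r1 H.
  by rewrite !mulr_ge0 // exprn_ge0.
by congr (_ <= _); ring.
Qed.

(** After the terms at 0 are split off, the relation turns the remaining sum into [- c * csum F1],
    which joins the middle coefficient. *)
Lemma csum_three_term r F0 F1 F2 (c : C) : 0 <= r -> r < 1 ->
  dominated r F0 -> dominated r F1 -> dominated r F2 ->
  (forall n, F2 n.+1 - 2 * F1 n.+1 + F0 n.+1 = - (c * F1 n)) ->
  csum F2 - (2 - c) * csum F1 + csum F0 = F2 0 - 2 * F1 0 + F0 0.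
Proof.
move=> r0 r1 d0 d1 d2 E.
have S a := dominated_csummable r a r0 r1.
have d1' : dominated r (fun n => -2 * F1 n) by exact: dominatedZ.
have d12 : dominated r (fun n => F2 n + -2 * F1 n) by exact: dominatedD.
have E1 : csum (fun n => F2 n + -2 * F1 n + F0 n)
    = csum F2 + -2 * csum F1 + csum F0.
  by rewrite (csumD _ _ _ (S _ d12) (S _ d0)) (csumD _ _ _ (S _ d2) (S _ d1'))
    (csumZ _ _ _ (S _ d1)).
have E2 : csum (fun n => F2 n.+1 + -2 * F1 n.+1 + F0 n.+1) = - c * csum F1.
  rewrite -(csumZ _ _ _ (S _ d1)); congr csum; apply/funext => n.
  by rewrite mulNr mulNr E.
have := csum_recl _ _ (S _ (dominatedD _ _ _ d12 d0)); rewrite E1 E2 => E3.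
rewrite (_ : csum F2 - _ + _ = csum F2 + -2 * csum F1 + csum F0 + c * csum F1); last by ring.
by rewrite E3; ring.
Qed.

End Domination.

(** * Closed forms of the series of [x ^ s] and [s * x ^ s] *)

Section GeometricSums.
Variables (R : realType) (x : R[i]).
Hypothesis x1 : `|x| < 1.

Let x_neq1 : 1 - x != 0.
Proof. by rewrite subr_eq0; apply: contraTneq x1 => <-; rewrite normr1 ltxx. Qed.

Let dominated_exprS : dominated _ `|x| (fun s => x ^+ s.+1).
Proof. exact: dominated_shift (dominated_expr _ x). Qed.

Lemma csum_expr : csum (fun s => x ^+ s.+1) = x / (1 - x).
Proof.
have S := dominated_csummable _ _ _ (normr_ge0 _) x1 dominated_exprS.
have := csum_recl _ _ S; rewrite (_ : (fun _ => x ^+ _.+2) = fun s => x * x ^+ s.+1);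
  last by (apply/funext => s; rewrite exprS).
rewrite csumZ // expr1 => E; apply: (mulIf x_neq1); rewrite divfK //.
by rewrite mulrBr mulr1 {1}E; ring.
Qed.

(** Splitting off the first term gives [S = x + x * S + x * (x / (1 - x))] for the sum [S]. *)
Lemma csum_natr_expr : csum (fun s => s.+1%:R * x ^+ s.+1) = x / (1 - x) ^+ 2.
Proof.
have [|r /andP[r0 r1] Dr] := geo_dominated_natrM _ (fun s => x ^+ s.+1).
  by exists `|x|; rewrite ?normr_ge0 ?x1.
have S := dominated_csummable _ _ _ r0 r1 Dr.
have S0 := dominated_csummable _ _ _ (normr_ge0 _) x1 dominated_exprS.
have Sx := dominated_csummable _ _ _ r0 r1 (dominatedZ _ _ x _ Dr).
have Sx0 := dominated_csummable _ _ _ (normr_ge0 _) x1 (dominatedZ _ _ x _ dominated_exprS).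
have := csum_recl _ _ S.
rewrite (_ : (fun _ => _.+2%:R * x ^+ _.+2) =
  fun s => x * (s.+1%:R * x ^+ s.+1) + x * x ^+ s.+1); last first.
  by apply/funext => s; rewrite exprS -[s.+2%:R]natr1; ring.
rewrite csumD // !csumZ // csum_expr expr1 mul1r => E.
have E' : csum (fun s => s.+1%:R * x ^+ s.+1) * (1 - x) = x / (1 - x).
  by rewrite mulrBr mulr1 {1}E; field.
by rewrite expr2 invfM mulrA -E' mulfK.
Qed.

End GeometricSums.

(** * The q-series inside the unit disc *)

Section QSeries.
Variables (R : realType) (q : R[i]).
Hypotheses (q0 : q != 0) (q1 : `|q| < 1).
Implicit Types (m : int) (n k : nat).

Let q_gt0 : 0 < `|q|. Proof. by rewrite normr_gt0. Qed.
Let subq_gt0 : 0 < 1 - `|q|. Proof. by rewrite subr_gt0. Qed.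

Lemma norm_exprS_le n : `|q ^+ n.+1| <= `|q|.
Proof. by rewrite normrX exprS ler_piMr // exprn_ile1 // ltW. Qed.

Lemma norm_exprS_lt1 n : `|q ^+ n.+1| < 1.
Proof. exact: le_lt_trans (norm_exprS_le n) q1. Qed.

Lemma norm_sub1_exprS n : 1 - `|q| <= `|1 - q ^+ n.+1|.
Proof.
apply: le_trans (lerB_dist _ _); rewrite normr1 lerB //; exact: norm_exprS_le.
Qed.

Lemma sub1_exprS_neq0 n : 1 - q ^+ n.+1 != 0.
Proof. by rewrite -normr_gt0; apply: lt_le_trans (norm_sub1_exprS n). Qed.

Lemma qpoch_neq0 n : qpoch q q n != 0.
Proof. by apply/prodf_neq0 => i _; rewrite -exprS; exact: sub1_exprS_neq0. Qed.

(** Uniformity in [n] is what makes [Ekn k n q] bounded in [n]: the power is at most [|q| ^+ s.+1]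
    and the denominator at least [1 - |q|] in norm. *)
Lemma Ekn_term_bound k : exists r M : R[i], [/\ 0 <= r, r < 1, 0 <= M &
  forall n s, `|(s.+1)%:R ^+ k.-1 * q ^+ (s.+1 * n.+1) / (1 - q ^+ s.+1)|
    <= M * r ^+ s].
Proof.
have [|r /andP[r0 r1] [M M0 B]] := geo_dominated_polyM _ k.-1 (fun s => q ^+ s.+1).
  exists `|q|; rewrite ?normr_ge0 ?q1 //.
  exact: dominated_shift (dominated_expr _ q).
exists r, (M / (1 - `|q|)); split=> // [|n s]; first by rewrite divr_ge0 // ltW.
rewrite normrM normfV mulrAC ler_pM // ?invr_ge0 //; last first.
  by rewrite lef_pV2 ?posrE ?norm_sub1_exprS ?normr_gt0 ?sub1_exprS_neq0.
apply: le_trans (B s); rewrite !normrM ler_wpM2l // !normrX mulnS exprD.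
by rewrite ler_piMr ?exprn_ge0 ?exprn_ile1 // ltW.
Qed.

Lemma Ekn_csummable k n : csummable _
  (fun s => (s.+1)%:R ^+ k.-1 * q ^+ (s.+1 * n.+1) / (1 - q ^+ s.+1)).
Proof.
have [r [M [r0 r1 M0 B]]] := Ekn_term_bound k.
by have [] := csum_geometric_bound _ _ _ _ M0 r0 r1 (B n).
Qed.

Lemma Ekn_bounded k : dominated _ 1 (fun n => Ekn k n q).
Proof.
have [r [M [r0 r1 M0 B]]] := Ekn_term_bound k.
exists (2 * M / (1 - r)); first by rewrite divr_ge0 ?subr_ge0 ?(ltW r1) // mulr_ge0.
move=> n; rewrite expr1n mulr1.
by have [] := csum_geometric_bound _ _ _ _ M0 r0 r1 (B n).
Qed.

(** Subtracting the terms for [n.+1] from those for [n] produces a factor [1 - q ^+ s.+1], which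
    cancels the denominator. *)
Lemma Ekn_succ k n :
  Ekn k n q = csum (fun s => (s.+1)%:R ^+ k.-1 * (q ^+ n.+1) ^+ s.+1) + Ekn k n.+1 q.
Proof.
have -> : (fun s => (s.+1)%:R ^+ k.-1 * (q ^+ n.+1) ^+ s.+1) = fun s =>
    (s.+1)%:R ^+ k.-1 * q ^+ (s.+1 * n.+1) / (1 - q ^+ s.+1) +
    -1 * ((s.+1)%:R ^+ k.-1 * q ^+ (s.+1 * n.+2) / (1 - q ^+ s.+1)).
  apply/funext => s; rewrite -exprM [(s.+1 * n.+2)%N]mulnS exprD [(n.+1 * _)%N]mulnC.
  by field; exact: sub1_exprS_neq0.
rewrite csumD ?csumZ; [|exact: Ekn_csummable..|]; last first.
  have [r [M [r0 r1 M0 B]]] := Ekn_term_bound k.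
  apply: (dominated_csummable _ _ _ r0 r1); apply: dominatedZ.
  by exists M => //; apply: B.
by rewrite -/(Ekn k n q) -/(Ekn k n.+1 q); ring.
Qed.

Lemma E1_succ n : Ekn 1 n q = q ^+ n.+1 / (1 - q ^+ n.+1) + Ekn 1 n.+1 q.
Proof.
rewrite Ekn_succ /= -(csum_expr _ _ (norm_exprS_lt1 n)); congr (csum _ + _).
by apply/funext => s; rewrite mul1r.
Qed.

Lemma E2_succ n : Ekn 2 n q = q ^+ n.+1 / (1 - q ^+ n.+1) ^+ 2 + Ekn 2 n.+1 q.
Proof.
rewrite Ekn_succ /= -(csum_natr_expr _ _ (norm_exprS_lt1 n)); congr (csum _ + _).
Qed.

(** * Behaviour of terms and weights in [n] and [m] *)

Lemma Gterm0 m : Gterm m q 0 = 1.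
Proof. by rewrite /Gterm /qpoch big_ord0 mul0n mulr0 !expr1n divr1 expr0 mul1r. Qed.

Lemma Gterm_succ_index m n : Gterm m q n.+1 * (1 - q ^+ n.+1) ^+ 2
  = - (q ^+ n.+1 * q ^ m * Gterm m q n).
Proof.
(* The truncated halves differ by exactly [n.+1], since the products differ by the even number
   [n.+1.*2]. *)
have half : ((n.+1 * n.+2)./2 = (n * n.+1)./2 + n.+1)%N.
  have -> : (n.+1 * n.+2 = n * n.+1 + n.+1.*2)%N by lia.
  by rewrite halfD odd_double andbF doubleK.
rewrite /Gterm half /qpoch big_ord_recr /= -/(qpoch q q n).
have := qpoch_neq0 n; set p := qpoch q q n => p0.
rewrite -exprS (_ : _ + m * _ = (n * n.+1)./2%:Z + m * n%:Z + (n.+1%:Z + m));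
  last by rewrite PoszD intS; ring.
rewrite [q ^ (_ + (_ + m))]expfzDr // [q ^ (_ + m)]expfzDr // -exprnP exprS.
by field; rewrite p0 sub1_exprS_neq0.
Qed.

Lemma Gterm_succ m n : Gterm (m + 1) q n = q ^+ n * Gterm m q n.
Proof. by rewrite /Gterm mulrDl mul1r addrA expfzDr // -exprnP; ring. Qed.

Lemma Lnm_succ m n : Lnm (m + 1) q n = Lnm m q n + 1.
Proof. by rewrite /Lnm intrD; ring. Qed.

Lemma Lnm_succ_index m n :
  Lnm m q n.+1 = Lnm m q n + 1 + 2 * (q ^+ n.+1 / (1 - q ^+ n.+1)).
Proof. by rewrite /Lnm (E1_succ n) -natr1; ring. Qed.

(** The quadratic exponent makes the ratio of consecutive terms tend to 0, so [s] may be as small as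
    desired. *)
Lemma Gterm_dominated m (s : R[i]) : 0 < s -> dominated _ s (Gterm m q).
Proof.
move=> s0; have qm0 : 0 < `|q ^ m| by rewrite normr_gt0 expfz_neq0.
(* The threshold is [s * (1 - |q|) ^+ 2 / |q ^ m|], where [1 - |q|] bounds [|1 - q ^+ n.+1|] from
   below. *)
have [N qN] := exprn_small _ _ _ (ltW q_gt0) q1
  (divr_gt0 (mulr_gt0 s0 (exprn_gt0 2 subq_gt0)) qm0).
apply: dominated_ratio => //; exists N => n Nn.
have d0 : 0 < `|(1 - q ^+ n.+1) ^+ 2| by rewrite normr_gt0 expf_neq0 ?sub1_exprS_neq0.
rewrite -(ler_pM2r d0) -normrM Gterm_succ_index normrN normrM.
rewrite [X in _ <= X]mulrAC ler_wpM2r // normrM -ler_pdivlMr //.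
apply: (@le_trans _ _ (`|q| ^+ N)).
  by rewrite normrX; apply: ler_wiXn2l; rewrite ?(ltW q1) // ltnW.
apply: le_trans qN _; rewrite ler_wpM2r ?invr_ge0 //.
rewrite ler_wpM2l ?(ltW s0) // normrX lerXn2r ?nnegrE ?(ltW subq_gt0) //.
exact: norm_sub1_exprS.
Qed.

Definition Pnm m n := 2^-1 * (Lnm m q n) ^+ 2 - Ekn 2 n q - 24%:R^-1 * E2 q.

Lemma Lnm_dominated m : dominated _ 2 (Lnm m q).
Proof.
have W a : dominated _ 1 a -> dominated R 2 a by apply: dominatedW; rewrite ?ler1n.
apply: (eq_dominated _ _ (fun n => n%:R + (m%:~R + 2^-1) + - 2 * Ekn 1 n q)).
  by move=> n; rewrite /Lnm; ring.
apply: dominatedD; last by apply: W; apply: dominatedZ; exact: Ekn_bounded.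
apply: dominatedD; last by apply: W; exact: dominated_cst.
by have := dominated_natr R 1 ltr01.
Qed.

Lemma Pnm_dominated m : dominated _ (2 * 2) (Pnm m).
Proof.
have W a : dominated _ 1 a -> dominated R (2 * 2) a.
  by apply: dominatedW; rewrite // -natrM ler1n.
apply: (eq_dominated _ _ (fun n => 2^-1 * (Lnm m q n * Lnm m q n) + -1 * Ekn 2 n q
    + - (24%:R^-1 * E2 q))).
  by move=> n; rewrite /Pnm; ring.
apply: dominatedD; last by apply: W; exact: dominated_cst.
apply: dominatedD; last by apply: W; apply: dominatedZ; exact: Ekn_bounded.
by apply: dominatedZ; apply: dominatedM; exact: Lnm_dominated.
Qed.

(** Decay of [Gterm] at ratio [s^-1 / 2] outweighs growth at ratio [s]; the fixed target [2^-1]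
    gives all families one common ratio. *)
Lemma weighted_Gterm_dominated m (s : R[i]) a : 0 < s -> dominated _ s a ->
  dominated _ 2^-1 (fun n => a n * Gterm m q n).
Proof.
move=> s0 da; have -> : 2^-1 = s * (s^-1 / 2) by rewrite mulrA mulfV ?mul1r ?lt0r_neq0.
by apply: dominatedM => //; apply: Gterm_dominated; rewrite divr_gt0 // invr_gt0.
Qed.

Let half_ge0 : 0 <= 2^-1 :> R[i]. Proof. by rewrite invr_ge0. Qed.
Let half_lt1 : 2^-1 < 1 :> R[i]. Proof. by rewrite invf_lt1 // ltr1n. Qed.

Lemma G0_dominated m : dominated _ 2^-1 (Gterm m q).
Proof. by apply: Gterm_dominated; rewrite invr_gt0. Qed.

Lemma G1_dominated m : dominated _ 2^-1 (fun n => Lnm m q n * Gterm m q n).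
Proof. by apply: weighted_Gterm_dominated (Lnm_dominated m). Qed.

Lemma G2_dominated m : dominated _ 2^-1 (fun n => Pnm m n * Gterm m q n).
Proof. by apply: weighted_Gterm_dominated (Pnm_dominated m); rewrite mulr_gt0. Qed.

Lemma Gterm_succ_indexE m n : Gterm m q n.+1
  = - (q ^+ n.+1 * q ^ m * Gterm m q n) / (1 - q ^+ n.+1) ^+ 2.
Proof. by rewrite -Gterm_succ_index mulfK // expf_neq0 // sub1_exprS_neq0. Qed.

(** * Three-term recursions in [m] *)

Lemma G0s_rec m :
  G0s (m + 1 + 1) q - (2 - q ^ (m + 1)) * G0s (m + 1) q + G0s m q = 0.
Proof.
rewrite /G0s (csum_three_term _ _ _ _ _ _ half_ge0 half_lt1
  (G0_dominated _) (G0_dominated _) (G0_dominated _)).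
  by rewrite !Gterm0; ring.
(* The second difference in [m] multiplies [Gterm m q n.+1] by [(1 - q ^+ n.+1) ^+ 2], which clears
   its new denominator. *)
move=> n; rewrite !Gterm_succ Gterm_succ_indexE (expfzDr m 1) // expr1z [q ^+ n.+1]exprS.
by field; rewrite -exprS sub1_exprS_neq0.
Qed.

Lemma G1s_rec m :
  G1s (m + 1 + 1) q - (2 - q ^ (m + 1)) * G1s (m + 1) q + G1s m q = 0.
Proof.
rewrite /G1s (csum_three_term _ _ _ _ _ _ half_ge0 half_lt1
  (G1_dominated _) (G1_dominated _) (G1_dominated _)).
  by rewrite !Gterm0 !Lnm_succ; ring.
(* With [y = q ^+ n.+1], the part [2 * y / (1 - y)] gained by [Lnm] from [n] to [n.+1] cancels the
   cross term [- 2 * y * (1 - y)] of the second difference. *)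
move=> n; rewrite !Lnm_succ !Gterm_succ Lnm_succ_index Gterm_succ_indexE.
rewrite (expfzDr m 1) // expr1z [q ^+ n.+1]exprS.
by field; rewrite -exprS sub1_exprS_neq0.
Qed.

Lemma G2s_rec m :
  G2s (m + 1 + 1) q - (2 - q ^ (m + 1)) * G2s (m + 1) q + G2s m q = 1.
Proof.
rewrite /G2s (csum_three_term _ _ _ _ _ _ half_ge0 half_lt1
  (G2_dominated _) (G2_dominated _) (G2_dominated _)).
  (* The 1 is the second difference of half a square under unit steps of [Lnm]; the other parts of
     the weight cancel. *)
  by rewrite !Gterm0 /Pnm !Lnm_succ; field.
(* The quadratic part now leaves [- q ^+ n.+1], compensated by the change of [Ekn 2] from [n] to
   [n.+1]. *)
move=> n; rewrite /Pnm !Lnm_succ !Gterm_succ Lnm_succ_index Gterm_succ_indexE.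
rewrite (E2_succ n) (expfzDr m 1) // expr1z [q ^+ n.+1]exprS.
by field; rewrite -exprS sub1_exprS_neq0.
Qed.

(** * The Wronskian of [G1s] and [G0s] *)

Definition wronskian m := G1s m q * G0s (m + 1) q - G1s (m + 1) q * G0s m q.

(** Both recursions are homogeneous with the same middle coefficient, so the products containing
    that coefficient cancel. *)
Lemma wronskian_succ m : wronskian (m + 1) = wronskian m.
Proof.
rewrite /wronskian.
have /eqP := G0s_rec m; rewrite addr_eq0 subr_eq => /eqP ->.
have /eqP := G1s_rec m; rewrite addr_eq0 subr_eq => /eqP ->.
ring.
Qed.

Lemma wronskian_cst m : wronskian m = wronskian 0.
Proof.
elim/int_rec: m => // n IH; first by rewrite -addn1 PoszD wronskian_succ.
by rewrite -IH -[in LHS]wronskian_succ; congr wronskian; rewrite -addn1 PoszD; ring.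
Qed.

Lemma Gterm_nat n k : Gterm n%:Z q k = (q ^+ k) ^+ n * Gterm 0 q k.
Proof.
elim: n => [|n IH]; first by rewrite mul1r.
by rewrite -addn1 PoszD Gterm_succ IH exprD expr1; ring.
Qed.

Lemma Lnm_nat n k : Lnm n%:Z q k = Lnm 0 q k + n%:R.
Proof. by rewrite /Lnm mulr0z -pmulrn; ring. Qed.

Let Hs n := csum (fun k => (q ^+ k) ^+ n * (Lnm 0 q k * Gterm 0 q k)).

Lemma G0s_cvg : dominated _ `|q| (fun n => G0s n%:Z q - 1).
Proof.
have := csum_exprM_cvg _ _ _ _ (ltW q1) half_ge0 half_lt1 (G0_dominated 0).
apply: eq_dominated => n; rewrite Gterm0; congr (csum _ - _).
by apply/funext => k; rewrite Gterm_nat.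
Qed.

Lemma Hs_cvg : dominated _ `|q| (fun n => Hs n - Lnm 0 q 0).
Proof.
have := csum_exprM_cvg _ _ _ _ (ltW q1) half_ge0 half_lt1 (G1_dominated 0).
by rewrite Gterm0 mulr1.
Qed.

Lemma G1s_nat n : G1s n%:Z q = Hs n + n%:R * G0s n%:Z q.
Proof.
have S a := dominated_csummable _ _ a half_ge0 half_lt1.
have -> : Hs n = csum (fun k => Lnm n%:Z q k * Gterm n%:Z q k
    + - n%:R * Gterm n%:Z q k).
  by congr csum; apply/funext => k; rewrite Lnm_nat Gterm_nat; ring.
rewrite csumD; [|by apply: S; exact: G1_dominated|]; last first.
  by apply: S; apply: dominatedZ; exact: G0_dominated.
rewrite csumZ; last by apply: S; exact: G0_dominated.
by rewrite -/(G1s _ _) -/(G0s _ _); ring.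
Qed.

(* Writing [G1s n = Hs n + n * G0s n] cancels the growing part, and
   [Hs n], [G0s n] converge geometrically to [Lnm 0 q 0] and [1]. *)
Lemma wronskianE m : wronskian m = -1.
Proof.
rewrite wronskian_cst; apply/eqP; rewrite -addr_eq0; apply/eqP.
apply: (dominated_cst_eq0 _ _ _ (ltW q_gt0) q1).
set c := Lnm 0 q 0.
pose x n := G0s n%:Z q - 1; pose y n := Hs n - c.
(* An expansion of the Wronskian plus 1 in which every summand contains a value of [x] or [y], hence
   decays like [|q| ^+ n]. *)
apply: (eq_dominated _ _ (fun n => y n * (x n.+1 + 1) + -1 * (y n.+1 * (x n + 1))
   + c * x n.+1 + - c * x n + -1 * (x n.+1 * (x n + 1)) + -1 * x n)).
  move=> n; rewrite -(wronskian_cst n%:Z) /wronskian.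
  have -> : n%:Z + 1 = n.+1%:Z by rewrite -addn1 PoszD.
  by rewrite !G1s_nat /x /y -[n.+1%:R]natr1; ring.
have dS a : dominated _ `|q| a -> dominated _ `|q| (fun n => a n.+1).
  exact: dominated_shift (ltW q_gt0).
have dx : dominated _ `|q| x := G0s_cvg.
have dy : dominated _ `|q| y := Hs_cvg.
have bx : dominated _ 1 (fun n => x n + 1).
  apply: dominatedD; last exact: dominated_cst.
  by apply: dominatedW dx; rewrite ?(ltW q_gt0) ?(ltW q1).
have bxS : dominated _ 1 (fun n => x n.+1 + 1) by exact: dominated_shift bx.
have M a b : dominated _ `|q| a -> dominated _ 1 b ->
    dominated _ `|q| (fun n => a n * b n).
  by move=> da db; rewrite -[`|q|]mulr1; exact: dominatedM.
have dxS := dS _ dx; have dyS := dS _ dy.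
apply: dominatedD; last exact: dominatedZ dx.
apply: dominatedD; last exact: dominatedZ (M _ _ dxS bx).
apply: dominatedD; last exact: dominatedZ dx.
apply: dominatedD; last exact: dominatedZ dxS.
apply: dominatedD; first exact: M dy bxS.
exact: dominatedZ (M _ _ dyS bx).
Qed.

End QSeries.

(** * Passage to [|q| > 1] *)

Section Extension.
Variables (R : realType) (q : R[i]).
Hypotheses (q0 : q != 0) (q1 : `|q| != 1).

Lemma norm_inv_lt1 : (`|q^-1| < 1) = ~~ (`|q| < 1).
Proof.
rewrite normfV invf_lt1 ?normr_gt0 //.
have [//|//|E] := real_ltgtP (normr_real q) (@real1 R[i]).
by have := q1; rewrite E eqxx.
Qed.

(** Exactly one of [q] and [q^-1] lies in the unit disc: for [q] this is the definition of [G], for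
    [q^-1] the two signs cancel. *)
Lemma G_inv j m : G j m q^-1 = (-1) ^+ j * G j (- m) q.
Proof.
by rewrite /G norm_inv_lt1; case: (`|q| < 1) => /=; rewrite ?invrK ?opprK ?signrMK.
Qed.

(** [Gs] sends every [j >= 2] to [G2s], hence the test [1 < j]. *)
Lemma Gs_rec j m (p : R[i]) : p != 0 -> `|p| < 1 ->
  Gs j (m + 1 + 1) p - (2 - p ^ (m + 1)) * Gs j (m + 1) p + Gs j m p
  = (1 < j)%N%:R.
Proof.
move=> p0 p1; case: j => [|[|j]] /=; first exact: G0s_rec.
- exact: G1s_rec.
- exact: G2s_rec.
Qed.

Lemma G_rec j m : (j <= 2)%N ->
  G j (m + 1 + 1) q - (2 - q ^ (m + 1)) * G j (m + 1) q + G j m q = (j == 2)%:R.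
Proof.
move=> j2; have -> : (j == 2) = (1 < j)%N by lia.
rewrite /G; case: ifPn => [lt1|]; first exact: Gs_rec.
rewrite -norm_inv_lt1 => lt1.
(* The recursion at [q^-1], started from [- (m + 2)], reverses the three indices and keeps the
   coefficient, as [q^-1 ^ (- (m + 1)) = q ^ (m + 1)]. *)
have := Gs_rec j (- (m + 1 + 1)) q^-1; rewrite invr_eq0 => /(_ q0 lt1).
have -> : - (m + 1 + 1) + 1 = - (m + 1) by ring.
have -> : - (m + 1) + 1 = - m by ring.
rewrite exprz_inv opprK => E.
(* The sign is harmless: the right-hand side is nonzero only at [j = 2]. *)
transitivity ((-1) ^+ j * (1 < j)%N%:R : R[i]); first by rewrite -E; ring.
by case: j j2 {E} => [|[|[|j]]] //= _; rewrite ?mulr0 // sqrrN expr1n mul1r.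
Qed.

(** For [|q| > 1] the sign of [G 1] and the reversal of the two columns each negate the determinant,
    so the value from the disc persists. *)
Lemma G_wronskian m : G 1 m q * G 0 (m + 1) q - G 1 (m + 1) q * G 0 m q = -1.
Proof.
rewrite /G; case: ifPn => [lt1|]; first exact: wronskianE.
rewrite -norm_inv_lt1 => lt1; rewrite /= expr0 expr1 !mul1r !mulN1r.
have := wronskianE _ q^-1; rewrite invr_eq0 => /(_ q0 lt1 (- (m + 1))) <-; rewrite /wronskian.
have -> : - (m + 1) + 1 = - m by ring.
by ring.
Qed.

End Extension.

(** * Explicit 3 by 3 matrices *)

Section Matrix3.
Variable R : realType.

Lemma mulmx_mx3 (a b c d e f g h k a' b' c' d' e' f' g' h' k' : R[i]) :
  mx3 a b c d e f g h k *m mx3 a' b' c' d' e' f' g' h' k' =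
  mx3 (a * a' + b * d' + c * g') (a * b' + b * e' + c * h') (a * c' + b * f' + c * k')
      (d * a' + e * d' + f * g') (d * b' + e * e' + f * h') (d * c' + e * f' + f * k')
      (g * a' + h * d' + k * g') (g * b' + h * e' + k * h') (g * c' + h * f' + k * k').
Proof.
by apply/matrixP => -[[|[|[|//]]] ?] [[|[|[|//]]] ?];
  rewrite !mxE !big_ord_recr big_ord0 /= !mxE /= add0r.
Qed.

Lemma det_mx3_col0 (a b c e f h k : R[i]) :
  \det (mx3 a b c 0 e f 0 h k) = a * (e * k - f * h).
Proof.
rewrite (expand_det_col _ ord0) !big_ord_recl big_ord0 !mxE /= !mul0r !addr0.
rewrite /cofactor (expand_det_row _ ord0) !big_ord_recl big_ord0 /cofactor !det_mx11.
by rewrite !mxE /=; ring.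
Qed.

End Matrix3.

Theorem theorem2p1 (R : realType) (m : int) (q : R[i]) :
  q != 0 -> `|q| != 1 ->
  [/\ Jmx (m + 1) q = Jmx m q *m Amx m q,
      \det (Jmx m q) = -1
    & Jmx m q^-1 = mx3 1 0 0  0 (-1) 0  0 0 1 *m Jmx (- m - 1) q *m mx3 1 0 0  0 0 1  0 1 0].
Proof.
move=> q0 q1; split.
(* Solved for index [m + 2], the recursion is the last column of [Amx]; its top entry 1 is the
   inhomogeneity at [j = 2]. *)
- have rec j : (j <= 2)%N -> G j (m + 1 + 1) q =
      (j == 2)%:R - G j m q + (2 - q ^ (m + 1)) * G j (m + 1) q.
    by move=> j2; rewrite -(G_rec _ _ q0 q1 j m j2); ring.
  by rewrite /Jmx /Amx mulmx_mx3 !rec //=; congr mx3; ring.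
- by rewrite /Jmx det_mx3_col0 mul1r; exact: G_wronskian.
(* Inversion sends the indices [m], [m + 1] to [- m], [- m - 1], which accounts for the column swap;
   the signs [(-1) ^+ j] give the diagonal factor. *)
- rewrite /Jmx !mulmx_mx3 !G_inv //.
  have -> : - m - 1 + 1 = - m by ring.
  have -> : - (m + 1) = - m - 1 by ring.
  by congr mx3; ring.
Qed.
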